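(* Let $R=\mathbb{F}_2[x^{\pm1},y^{\pm1}]$. For $\alpha,\beta\in\mathbb{Z}_{\ge 0}$ and $a,b\in\mathbb{Z}$ put $$f=1+x+x^{-\alpha}y^{b},\qquad g=1+y+y^{-\beta}x^{a}\qquad (f,g\in R).$$ Then the bivariate-bicycle code $\mathbb{BB}(-\alpha,-\beta,a,b)$ defined by $f$ and $g$ is topological, i.e. the complex of $R$-modules $$R\xrightarrow{\;h_X=\binom{f}{g}\;}R^2\xrightarrow{\;h_Z^\dagger=(g\ \ f)\;}R$$ satisfies $\operatorname{im}h_X=\ker h_Z^\dagger$, for all $\alpha,\beta\in\mathbb{Z}_{\ge0}$ and $a,b\in\mathbb{Z}$ with the single exception of $(\alpha,\beta,a,b)=(0,0,1,1)$ (for which it is not topological).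
   Context: $R=\mathbb{F}_2[x^{\pm1},y^{\pm1}]$ is the Laurent polynomial ring over the field with two elements. The map $h_X:R\to R^2$ sends $r$ to $(fr,gr)$ and the map $h_Z^\dagger:R^2\to R$ sends $(u,v)$ to $gu+fv$. The code specified by $(f,g)$ is called topological if the three-term complex $R\to R^2\to R$ is exact at the middle term, i.e. $\operatorname{im}h_X=\ker h_Z^\dagger$. *)

(* Defs.v *)
From HB Require Import structures.
From mathcomp Require Import all_boot all_order all_algebra.
From mathcomp Require Import finmap.
From mathcomp Require Import monalg.

Set Implicit Arguments.
Unset Strict Implicit.
Unset Printing Implicit Defensive.

Import GRing.Theory.
Local Open Scope fset_scope.
Local Open Scope ring_scope.

(* k[x^{+-1}, y^{+-1}] as the group algebra of Z^2: a finitely supported family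
   of coefficients p@_(i, j), one for each monomial x^i y^j.  The library's ring
   structure on {malg k[K]} requires a monoid K without nontrivial units, which
   Z^2 is not; hence an alias that keeps the module structure of the library and
   receives its own convolution product. *)
Definition laurent (k : comNzRingType) : Type := {malg k[(int * int)%type]}.

HB.instance Definition _ (k : comNzRingType) := Choice.on (laurent k).
HB.instance Definition _ (k : comNzRingType) := GRing.Lmodule.on (laurent k).

Section LaurentRing.
Variable k : comNzRingType.
Implicit Types p q r : laurent k.
Local Notation E := (int * int)%type.

Definition lmul p q : laurent k :=
  \sum_(m <- msupp p) \sum_(n <- msupp q) << p@_m * q@_n *g m + n >>.

Definition lone : laurent k := << (0 : E) >>.

Lemma lmulw (d1 d2 : {fset E}) p q :
  msupp p `<=` d1 -> msupp q `<=` d2 ->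
  lmul p q = \sum_(m <- d1) \sum_(n <- d2) << p@_m * q@_n *g m + n >>.
Proof.
move=> le_d1 le_d2; rewrite /lmul (big_fset_incl _ le_d1) /=.
  apply/eq_bigr=> m _; apply/big_fset_incl => // n _ /mcoeff_outdom ->.
  by rewrite mulr0 monalgU0.
move=> m _ /mcoeff_outdom pm.
by rewrite big1 => // n _; rewrite pm mul0r monalgU0.
Qed.

Lemma lmulC : commutative lmul.
Proof.
move=> p q; rewrite /lmul exchange_big /=.
by apply/eq_bigr=> m _; apply/eq_bigr=> n _; rewrite mulrC addrC.
Qed.

Lemma lmul0g : left_zero (0 : laurent k) lmul.
Proof. by move=> p; rewrite /lmul msupp0 big_seq_fset0. Qed.

Lemma lmulUg c (m : E) p :
  lmul << c *g m >> p = \sum_(n <- msupp p) << c * p@_n *g m + n >>.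
Proof.
rewrite (lmulw msuppU_le (fsubset_refl _)) big_seq_fset1.
by apply/eq_bigr => n _; rewrite mcoeffUU.
Qed.

Lemma lmulUU c1 c2 (m n : E) :
  lmul << c1 *g m >> << c2 *g n >> = << c1 * c2 *g m + n >>.
Proof. by rewrite (lmulw msuppU_le msuppU_le) !big_seq_fset1 !mcoeffUU. Qed.

Lemma lmulEl p q : lmul p q = \sum_(m <- msupp p) lmul << p@_m *g m >> q.
Proof. by apply/eq_bigr=> m _; rewrite lmulUg. Qed.

Lemma lmul1g : left_id lone lmul.
Proof.
move=> p; rewrite lmulUg [RHS]monalgE.
by apply/eq_bigr=> m _; rewrite mul1r add0r.
Qed.

Lemma lmulDl : left_distributive lmul +%R.
Proof.
move=> p q r.
rewrite [in RHS](lmulw (fsubsetUl _ (msupp q)) (fsubset_refl _)).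
rewrite [in RHS](lmulw (fsubsetUr (msupp p) _) (fsubset_refl _)).
rewrite (lmulw (msuppD_le _ _) (fsubset_refl _)) -big_split /=.
apply/eq_bigr=> m _; rewrite -big_split /=; apply/eq_bigr=> n _.
by rewrite mcoeffD mulrDl monalgUD.
Qed.

Lemma lmulDr : right_distributive lmul +%R.
Proof. by move=> p q r; rewrite lmulC lmulDl !(lmulC p). Qed.

Lemma lmulg0 : right_zero (0 : laurent k) lmul.
Proof. by move=> p; rewrite lmulC lmul0g. Qed.

Lemma lmulA : associative lmul.
Proof.
move=> p q r.
rewrite [RHS](big_morph (lmul^~ _) (fun _ _ => lmulDl _ _ _) (lmul0g _)).
rewrite lmulEl; apply/eq_bigr=> m1 _.
rewrite [LHS](big_morph (lmul _) (fun _ _ => lmulDr _ _ _) (lmulg0 _)).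
rewrite [RHS](big_morph (lmul^~ _) (fun _ _ => lmulDl _ _ _) (lmul0g _)).
apply/eq_bigr=> m2 _.
rewrite [LHS](big_morph (lmul _) (fun _ _ => lmulDr _ _ _) (lmulg0 _)).
rewrite [RHS]lmulC [RHS]lmulEl; apply/eq_bigr=> m3 _.
by rewrite [RHS]lmulC !lmulUU mulrA addrA.
Qed.

Lemma lone_neq0 : lone != 0.
Proof. by apply/eqP/malgP=> /(_ 0) /eqP; rewrite !mcoeffsE oner_eq0. Qed.

HB.instance Definition _ := GRing.Zmodule_isComNzRing.Build (laurent k)
  lmulA lmulC lmul1g lmulDl lone_neq0.

(* x^i y^j *)
Definition mon (i j : int) : laurent k := << (i, j) >>.

Lemma mon0 : mon 0 0 = 1. Proof. by []. Qed.

Lemma monM i j i' j' : mon i j * mon i' j' = mon (i + i') (j + j').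
Proof. by rewrite [LHS]lmulUU mulr1. Qed.

End LaurentRing.

Arguments mon {k} i j.

Section Code.
Variables (R : comNzRingType) (f g : R).

Definition hX (r : R^o) : (R^o * R^o)%type := (f * r, g * r).

Definition hZdag (w : (R^o * R^o)%type) : R^o := g * w.1 + f * w.2.

Fact hX_is_linear : linear hX.
Proof. by move=> c r s; congr pair; rewrite /= mulrDr !scalerAr. Qed.
HB.instance Definition _ :=
  GRing.isLinear.Build R R^o (R^o * R^o)%type _ hX hX_is_linear.

Fact hZdag_is_linear : linear hZdag.
Proof.
move=> c v w; rewrite -[RHS]/(c * (g * v.1 + f * v.2) + (g * w.1 + f * w.2)).
rewrite -[LHS]/(g * (c * v.1 + w.1) + f * (c * v.2 + w.2)).
by rewrite !mulrDr addrACA !(mulrCA c).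
Qed.
HB.instance Definition _ :=
  GRing.isLinear.Build R (R^o * R^o)%type R^o _ hZdag hZdag_is_linear.

(* im hX = ker hZdag, both inclusions being required *)
Definition topological : Prop :=
  forall w : R^o * R^o, (exists r : R^o, hX r = w) <-> hZdag w = 0.

End Code.

(* Main.v *)
From HB Require Import structures.
From mathcomp Require Import all_boot all_order all_algebra zify ring.
Require Import Defs.
From mathcomp Require Import finmap monalg.
Import GRing.Theory.
Import Pdiv.Ring Pdiv.RingMonic.
Local Open Scope ring_scope.

(* Over F_2, exactness in the middle says that g u = f v forces (u, v) to be a
   multiple of (f, g), i.e. that g is a nonzerodivisor modulo f.  Put z = y if
   b >= 0 and z = y^-1 otherwise.  Up to monomials, f is the polynomial
   F = x^alpha (x + 1) + z^|b|, monic in x over F_2[z], so F_2[x, z]/(F) is a free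
   F_2[z]-module.  Up to monomials, g is a polynomial G which is congruent to a
   monomial modulo z + 1 (as 1 + y vanishes at y = 1).  If F and G are coprime at
   some point z = c and F divides G U, with U reduced modulo F, then z - c divides
   U, and so does each of its powers by descent, whence U = 0.  The point c = 1
   works if alpha > 0, or if a power of x can be cleared from G, and c = 0 works
   if b < 0 <= a.  When alpha = 0 <= b and a > 0, F is linear in x and it suffices
   that G does not vanish at the root x = 1 + y^b of F, i.e. that
   (1 + y) y^beta <> (1 + y^b)^a: this fails only for beta = 0, a = b = 1, when
   f = g = 1 + x + y is not a unit. *)

(** * Nonzerodivisors modulo a monic polynomial, by specialization *)

Section Specialization.
Variables (k : fieldType) (c : k) (F G : {poly {poly k}}).
Local Notation ev := (map_poly (horner_eval c)).
Hypotheses (F_monic : F \is monic) (coFG : coprimep (ev F) (ev G)).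

(** As [F] is monic, [ev F] keeps its degree; coprime to [ev G], it divides [ev U], which has
    smaller degree and so is 0. *)
Lemma specialization_descent (U : {poly {poly k}}) :
  (size U < size F)%N -> rdvdp F (G * U) ->
  exists2 T, U = ('X - c%:P) *: T & (size T < size F)%N /\ rdvdp F (G * T).
Proof.
move=> ltUF dvFGU.
have evF_size : size (ev F) = size F.
  by rewrite size_map_poly_id0 // (monicP F_monic) horner_evalE hornerC oner_eq0.
have evU0 : ev U = 0.
  apply/eqP/negPn/negP => evU_neq0.
  have /(dvdp_leq evU_neq0) : ev F %| ev U.
    rewrite -(Gauss_dvdpr _ coFG) -rmorphM /=.
    have /(rdvdpP F_monic)[V ->] := dvFGU.
    by rewrite rmorphM /= dvdp_mull.
  by rewrite evF_size leqNgt (leq_ltn_trans (size_poly _ _)).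
pose T := map_poly (fun q : {poly k} => q %/ ('X - c%:P)) U.
have defU : U = ('X - c%:P) *: T.
  apply/polyP=> i; rewrite coefZ coef_map_id0 ?div0p // mulrC divpK //.
  by rewrite dvdp_XsubCl /root -horner_evalE -coef_map evU0 coef0.
have p_neq0 : 'X - c%:P != 0 :> {poly k} by rewrite polyXsubC_eq0.
exists T => //; split; first by rewrite -(size_scale _ p_neq0) -defU.
move: dvFGU; rewrite {1}defU -scalerAr /rdvdp rmodpZ // scale_poly_eq0.
by rewrite (negPf p_neq0).
Qed.

Lemma monic_dvd_of_specialization (U : {poly {poly k}}) :
  rdvdp F (G * U) -> rdvdp F U.
Proof.
move=> dvFGU; pose r := rmodp U F.
have F_neq0 := monic_neq0 F_monic.
have /eqP dvFGr : rmodp (G * r) F == 0 by rewrite rmodp_mulmr.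
have power_dvd n : exists2 T, r = ('X - c%:P) ^+ n *: T &
    (size T < size F)%N /\ rdvdp F (G * T).
  elim: n => [|n [T defr [ltTF dvFGT]]].
    by exists r; rewrite ?scale1r // ltn_rmodpN0 //; split=> //; apply/eqP.
  have [T' defT propT'] := specialization_descent _ ltTF dvFGT.
  by exists T' => //; rewrite defr defT scalerA exprSr.
apply/eqP/polyP=> i; rewrite coef0; apply/eqP/negPn/negP=> ri_neq0.
(* The power taken is the size of the coefficient itself, which exceeds its degree. *)
have [T /(congr1 (coefp i)) /=] := power_dvd (size r`_i).
rewrite coefZ => ri _; have := ri_neq0; rewrite {1}ri mulf_eq0 negb_or.
case/andP=> p_neq0 Ti_neq0; move/(congr1 (size : {poly k} -> nat)): ri.
rewrite size_mul // size_exp_XsubC addSn /= => e.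
move/eqP: e; rewrite -[X in X == _]addn0 eqn_add2l eq_sym size_poly_eq0.
by rewrite (negPf Ti_neq0).
Qed.

End Specialization.

(** * Polynomials in x and z inside the Laurent ring *)

Section Embedding.
Variable k : comNzRingType.
Local Notation L := (laurent k).

Definition lconst (c : k) : L := << c *g ((0, 0) : int * int) >>.

Fact lconst_is_zmod_morphism : zmod_morphism lconst.
Proof. by move=> c d; apply: monalgUB. Qed.

Fact lconst_is_monoid_morphism : monoid_morphism lconst.
Proof. by split=> // c d; rewrite -[RHS]/(lmul _ _) lmulUU. Qed.

HB.instance Definition _ :=
  GRing.isZmodMorphism.Build k L lconst lconst_is_zmod_morphism.
HB.instance Definition _ :=
  GRing.isMonoidMorphism.Build k L lconst lconst_is_monoid_morphism.

Lemma lconst_mon c i j : lconst c * mon i j = << c *g (i, j) >>.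
Proof.
rewrite -[LHS]/(lmul _ _) lmulUU mulr1.
by rewrite -[X in << _ *g X >>]/(0 + i, 0 + j) !add0r.
Qed.

Lemma monMU c i j i' j' :
  mon i j * (<< c *g (i', j') >> : L) = << c *g (i + i', j + j') >>.
Proof. by rewrite -[LHS]/(lmul _ _) lmulUU mul1r. Qed.

Lemma monX i j n : mon i j ^+ n = mon (i * n%:Z) (j * n%:Z) :> L.
Proof.
elim: n => [|n IHn]; first by rewrite !mulr0.
by rewrite exprS IHn monM; congr mon; lia.
Qed.

(* Polynomials in x and z = y^e; only e = 1 and e = -1 are used. *)
Variable e : int.

Fact y_comm : commr_rmorph lconst (mon 0 e : L).
Proof. by move=> c; apply: mulrC. Qed.

Fact x_comm : commr_rmorph (horner_morph y_comm) (mon 1 0 : L).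
Proof. by move=> p; apply: mulrC. Qed.

Definition iota : {rmorphism {poly {poly k}} -> L} := horner_morph x_comm.

Lemma iotaX : iota 'X = mon 1 0. Proof. exact: horner_morphX. Qed.

Lemma iotaC p : iota p%:P = horner_morph y_comm p.
Proof. exact: horner_morphC. Qed.

Lemma iotaY : iota 'X%:P = mon 0 e.
Proof. by rewrite iotaC horner_morphX. Qed.

Lemma iotaCC c : iota c%:P%:P = lconst c.
Proof. by rewrite iotaC horner_morphC. Qed.

Lemma iotaE U : iota U =
  \sum_(i < size U) \sum_(j < size U`_i) << U`_i`_j *g (i%:Z, e * j%:Z) >>.
Proof.
rewrite [LHS](horner_coef_wide _ (size_poly _ _)); apply: eq_bigr => i _.
rewrite coef_map /= [X in X * _](horner_coef_wide _ (size_poly _ _)) mulr_suml.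
apply: eq_bigr => j _; rewrite coef_map !monX -mulrA monM mul0r add0r mul1r.
by rewrite addr0 lconst_mon.
Qed.

Lemma mcoeff_iota U i j : e != 0 -> (iota U)@_(i%:Z, e * j%:Z) = U`_i`_j.
Proof.
move=> e_neq0; rewrite iotaE raddf_sum /=.
(* Writing a coefficient as a sum over the index range of [iotaE] allows a termwise comparison. *)
have coef_delta (R : nzSemiRingType) (p : {poly R}) n :
    p`_n = \sum_(m < size p) p`_m *+ (m == n :> nat).
  rewrite -{1}[p]coefK poly_def coef_sumMXn big_mkcond.
  by apply: eq_bigr => m _; case: eqP.
rewrite [U`_i]coef_delta coef_sum; apply: eq_bigr => m _.
rewrite raddf_sum coefMn [U`_m`_j]coef_delta -sumrMnl; apply: eq_bigr => n _.
rewrite /= mcoeffU -mulrnA xpair_eqE (inj_eq (mulfI e_neq0)) !eqz_nat.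
by rewrite -mulnb mulnC.
Qed.

Lemma iota_inj : e != 0 -> injective iota.
Proof.
move=> e_neq0 U V eqUV; apply/polyP=> i; apply/polyP=> j.
by have := congr1 (mcoeff (i%:Z, e * j%:Z)) eqUV; rewrite !mcoeff_iota.
Qed.

Lemma iota_mon i j : iota ('X^i * 'X%:P ^+ j) = mon i%:Z (e * j%:Z).
Proof.
rewrite rmorphM !rmorphXn iotaX iotaY [mon 1 0 ^+ _]monX [mon 0 e ^+ _]monX monM.
by rewrite mul1r !mul0r addr0 add0r.
Qed.

(** A large enough shift clears a single monomial; the product of two clearing monomials clears a
    sum. *)
Lemma laurent_clear_denominator (u : L) : e * e = 1 ->
  exists N M : nat, exists U, mon N%:Z (e * M%:Z) * u = iota U.
Proof.
move=> ee; pose cleared (v : L) :=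
  exists N M : nat, exists U, mon N%:Z (e * M%:Z) * v = iota U.
have clearedD v w : cleared v -> cleared w -> cleared (v + w).
  move=> [N [M [V defV]]] [N' [M' [W defW]]]; exists (N + N')%N, (M + M')%N.
  exists ('X^N' * 'X%:P ^+ M' * V + 'X^N * 'X%:P ^+ M * W).
  rewrite [iota (_ + _)]rmorphD [iota (_ * V)]rmorphM [iota (_ * W)]rmorphM !iota_mon.
  have -> : mon (N + N')%N%:Z (e * (M + M')%N%:Z) =
      mon N%:Z (e * M%:Z) * mon N'%:Z (e * M'%:Z) :> L.
    by rewrite monM !PoszD [e * (_ + _)]mulrDr.
  rewrite -defV -defW; move: (mon N _) (mon N' _) => m m'; ring.
have cleared_mon c i j : cleared << c *g (i, j) >>.
  have [n [p Ep]] : exists n p : nat, n%:Z + i = p%:Z.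
    by exists (absz i), (absz ((absz i)%:Z + i)); lia.
  (* Since [e * e = 1], [e * m + j = e * (m + e * j)], so [m + e * j] must be nonnegative. *)
  have [m [q Eq]] : exists m q : nat, m%:Z + e * j = q%:Z.
    by exists (absz (e * j)), (absz ((absz (e * j))%:Z + e * j)); lia.
  exists n, m, (c%:P%:P * ('X^p * 'X%:P ^+ q)).
  rewrite rmorphM iota_mon iotaCC -lconst_mon mulrCA monM -Ep -Eq.
  by rewrite mulrDr [e * (e * j)]mulrA ee mul1r.
rewrite [u]monalgE; apply: (big_ind cleared) => [||[i j] _].
- by exists 0, 0, 0; rewrite rmorph0 mulr0.
- exact: clearedD.
exact: cleared_mon.
Qed.

End Embedding.

(** * Transfer of regularity to the Laurent ring *)

Lemma mon_inv (k : comNzRingType) i j : mon i j * mon (- i) (- j) = 1 :> laurent k.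
Proof. by rewrite monM !subrr. Qed.

(** The surjectivity half of a localization: every element of [L] is a fraction of images of [h]. *)
Definition clears_denominators (A L : comNzRingType) (h : A -> L) :=
  forall u, exists P U, exists2 p', h P * p' = 1 & h P * u = h U.

Lemma iota_clears_denominators (k : comNzRingType) e :
  e * e = 1 -> clears_denominators _ _ (iota k e).
Proof.
move=> ee u; have [N [M [U defU]]] := laurent_clear_denominator k e u ee.
exists ('X^N * 'X%:P ^+ M), U; exists (mon (- N%:Z) (- (e * M%:Z)));
  by rewrite iota_mon ?mon_inv.
Qed.

Lemma exact_of_regular (k : idomainType) (L : comNzRingType)
    (h : {rmorphism {poly {poly k}} -> L}) (F G : {poly {poly k}}) (p p' q q' : L) :
  injective h -> clears_denominators _ _ h ->
  F \is monic -> (forall U, rdvdp F (G * U) -> rdvdp F U) ->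
  p * p' = 1 -> q * q' = 1 ->
  forall u v, (q * h G) * u = (p * h F) * v ->
  exists r, u = (p * h F) * r /\ v = (q * h G) * r.
Proof.
move=> h_inj h_clears F_monic regFG pp qq u v eq_uv.
(* Clearing [q * u] and [p * v] instead of [u] and [v] absorbs the units [p] and [q], so the
   equation descends to polynomials. *)
have [A [U [a' aa defU]]] := h_clears (q * u).
have [B [V [b' bb defV]]] := h_clears (p * v).
have eq_UV : G * (B * U) = F * (A * V).
  apply: h_inj; rewrite !rmorphM /= -defU -defV.
  transitivity (h A * h B * (q * h G * u)); first by ring.
  by rewrite eq_uv; ring.
have /(rdvdpP F_monic)[W defW] : rdvdp F (B * U).
  by apply: regFG; rewrite eq_UV mulrC rdvdp_mull.
have defVW : A * V = W * G.
  by apply: (mulfI (monic_neq0 F_monic)); rewrite -eq_UV defW; ring.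
have := congr1 h defW; have := congr1 h defVW; rewrite !rmorphM /= -defU -defV.
move: (h F) (h G) (h W) (h A) (h B) aa bb => f g w a b aa bb Ev Eu.
exists (a' * b' * p' * q' * w); split.
  transitivity ((p * p') * (a' * b' * q' * (w * f))); last by ring.
  rewrite pp -Eu; transitivity ((a * a') * (b * b') * (q * q') * u); last by ring.
  by rewrite aa bb qq !mul1r.
transitivity ((q * q') * (a' * b' * p' * (w * g))); last by ring.
rewrite qq -Ev; transitivity ((a * a') * (b * b') * (p * p') * v); last by ring.
by rewrite aa bb pp !mul1r.
Qed.

(** * The polynomials F and G, and regularity of G modulo F *)

(* The outer variable stands for x, that of the coefficients for z. *)
Definition Fpoly (alpha n : nat) : {poly {poly 'F_2}} :=
  'X^alpha * ('X + 1%:P) + ('X ^+ n)%:P.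

(** The first term is [1 + y] up to a monomial; the exponents leave room to clear negative powers
    for each sign of [a] and [b]. *)
Definition Gpoly (s t s' t' : nat) : {poly {poly 'F_2}} :=
  (('X + 1) * 'X ^+ s)%:P * 'X^t + ('X ^+ s')%:P * 'X^t'.

Lemma Fpoly_monic alpha n : Fpoly alpha n \is monic.
Proof.
have mon1 : 'X^alpha * ('X + 1%:P) \is @monic {poly 'F_2}.
  by rewrite monicMl ?monicXn // monicXaddC.
rewrite monicE lead_coefDl ?(monicP mon1) //.
rewrite (leq_ltn_trans (size_polyC_leq1 _)) // mulrC.
rewrite size_mulXn ?size_XaddC; first by lia.
by rewrite monic_neq0 // monicXaddC.
Qed.

Lemma Fpoly_at c alpha n : map_poly (horner_eval c) (Fpoly alpha n) =
  'X^alpha * ('X + 1) + (c ^+ n)%:P.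
Proof.
rewrite rmorphD rmorphM rmorphD /= map_polyXn map_polyX !map_polyC /=.
by rewrite !horner_evalE hornerC hornerXn.
Qed.

Lemma Gpoly_at c s t s' t' : map_poly (horner_eval c) (Gpoly s t s' t') =
  ((c + 1) * c ^+ s)%:P * 'X^t + (c ^+ s')%:P * 'X^t'.
Proof.
rewrite rmorphD !rmorphM /= !map_polyXn !map_polyC /= !horner_evalE.
by rewrite !hornerE.
Qed.

Lemma F2_add11 : 1 + 1 = 0 :> 'F_2. Proof. by apply/val_inj. Qed.

(** At z = 1, G becomes [x^t'], while F becomes [x^alpha (x + 1) + 1], which is 1 at x = 0 if
    [alpha > 0]. *)
Lemma Fpoly_regular_at1 alpha n s t s' t' : (0 < alpha)%N || (t' == 0)%N ->
  forall U, rdvdp (Fpoly alpha n) (Gpoly s t s' t' * U) ->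
  rdvdp (Fpoly alpha n) U.
Proof.
move=> cond; apply: (monic_dvd_of_specialization _ 1 _ _ (Fpoly_monic _ _)).
rewrite Fpoly_at Gpoly_at F2_add11 !expr1n mul0r mul0r add0r mul1r.
case: (posnP t') cond => [-> _|t'_gt0]; first by rewrite expr0 coprimep1.
rewrite orbF => alpha_gt0.
apply: coprimep_expr; rewrite coprimepX /root !hornerE.
by rewrite expr0n gtn_eqF // mul0r add0r oner_eq0.
Qed.

(** At z = 0 the second term of G dies and G becomes 1. *)
Lemma Fpoly_regular_at0 n s' t' : (0 < n)%N -> (0 < s')%N ->
  forall alpha U, rdvdp (Fpoly alpha n) (Gpoly 0 0 s' t' * U) ->
  rdvdp (Fpoly alpha n) U.
Proof.
move=> n_gt0 s'_gt0 alpha.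
apply: (monic_dvd_of_specialization _ 0 _ _ (Fpoly_monic _ _)).
by rewrite Gpoly_at !expr0 expr0n gtn_eqF // mul0r addr0 add0r !mulr1 coprimep1.
Qed.

Lemma F2poly_addrr (p : {poly 'F_2}) : p + p = 0.
Proof. by apply: addrr_pchar2; rewrite pchar_poly pchar_Fp. Qed.

Lemma Fpoly_regular_linear n s t : (0 < t)%N -> ~ [/\ s = 0, n = 1 & t = 1]%N ->
  forall U, rdvdp (Fpoly 0 n) (Gpoly s 0 0 t * U) -> rdvdp (Fpoly 0 n) U.
Proof.
move=> t_gt0 notex; pose c : {poly 'F_2} := 'X^n + 1.
have -> : Fpoly 0 n = 'X - c%:P.
  rewrite /Fpoly mul1r -addrA -polyCD; congr (_ + _); apply/eqP.
  by rewrite -addr_eq0 -polyCD [1 + _]addrC F2poly_addrr polyC0.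
move=> U; rewrite !rdvdp_XsubCl rootM => /orP[|//].
rewrite /root /Gpoly !hornerE => /eqP Gc0; case: notex.
have {Gc0} Gc : ('X + 1) * 'X ^+ s = c ^+ t.
  by apply: (addIr (c ^+ t)); rewrite F2poly_addrr.
(* If [n = 0] then [c = 0], whereas [(z + 1) z^s] is nonzero. *)
case: (posnP n) => [n0|n_gt0].
  move: Gc; rewrite /c n0 F2poly_addrr expr0n gtn_eqF // => /eqP.
  by rewrite mulf_eq0 expf_eq0 polyX_eq0 andbF orbF -size_poly_eq0 size_XaddC.
(* At z = 0 the right side is 1, so the left side has no factor z. *)
have s0 : s = 0%N.
  have := congr1 (fun p : {poly 'F_2} => p.[0]) Gc.
  rewrite /c !hornerE !expr0n (gtn_eqF n_gt0) !add0r expr1n.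
  by case: eqP => // _ /eqP; rewrite eq_sym oner_eq0.
(* Comparing degrees gives [1 = n * t]. *)
have := congr1 (fun p : {poly 'F_2} => (size p).-1) Gc.
rewrite s0 mulr1 size_exp /c size_XnaddC // size_XaddC /=.
by move/esym/eqP; rewrite muln_eq1 => /andP[/eqP-> /eqP->].
Qed.


(** * F and G as Laurent polynomials *)

Lemma iota_monX (k : comNzRingType) e n : iota k e 'X^n = mon n%:Z 0.
Proof. by rewrite rmorphXn iotaX monX mul1r mul0r. Qed.

Lemma iota_monY (k : comNzRingType) e n : iota k e ('X^n)%:P = mon 0 (e * n%:Z).
Proof. by rewrite polyC_exp rmorphXn iotaY monX mul0r. Qed.

Lemma iota_Fpoly e alpha n :
  mon (- alpha%:Z) 0 * iota 'F_2 e (Fpoly alpha n) =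
  1 + mon 1 0 + mon (- alpha%:Z) (e * n%:Z).
Proof.
rewrite [iota _ _ _]rmorphD [iota _ _ (_ * _)]rmorphM [iota _ _ (_ + _)]rmorphD.
rewrite iota_monX iota_monY iotaX rmorph1.
have cancel_alpha : mon (- alpha%:Z) 0 * mon alpha%:Z 0 = 1 :> laurent 'F_2.
  by rewrite monM addNr.
have -> : mon (- alpha%:Z) (e * n%:Z) =
    mon (- alpha%:Z) 0 * mon 0 (e * n%:Z) :> laurent 'F_2.
  by rewrite monM addr0 add0r.
by rewrite mulrDr mulrA cancel_alpha mul1r [1 + _]addrC.
Qed.

Lemma iota_Gpoly e s t s' t' : iota 'F_2 e (Gpoly s t s' t') =
  mon t%:Z (e * s%:Z) + mon t%:Z (e * s.+1%:Z) + mon t'%:Z (e * s'%:Z).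
Proof.
rewrite /Gpoly mulrDl mul1r -exprS polyCD mulrDl.
rewrite [LHS]rmorphD [iota _ _ (_ + _)]rmorphD ![iota _ _ (_ * _)]rmorphM.
rewrite !iota_monX !iota_monY.
have yx i j : mon 0 j * mon i 0 = mon i j :> laurent 'F_2.
  by rewrite monM add0r addr0.
by rewrite !yx [mon _ (_ * _.+1%:Z) + _]addrC.
Qed.

(** * The exceptional code *)

(* The weights of the three monomials of (1 + x + y) x^i y^j sum to 0, while that
   of 1 is not 0. *)
Definition residue_weight (m : int * int) : 'F_2 :=
  ((m.1 - m.2) %% 3 != 2)%Z%:R.

(** The three differences of exponents cover all residues mod 3, so exactly two weights are 1. *)
Lemma residue_weight_sum i j : residue_weight (i, j)
  + residue_weight (1 + i, j) + residue_weight (i, 1 + j) = 0.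
Proof.
rewrite /residue_weight /=.
by case: eqP; case: eqP; case: eqP => *; try (by apply/val_inj); exfalso; lia.
Qed.

(** Behind [phi] is evaluation at x = w, y = 1/w, with w a primitive cube root of unity in the field
    of four elements, followed by a linear form to ['F_2]; there 1 + x + y vanishes. *)
Lemma trinomial_not_unit (r : laurent 'F_2) : (1 + mon 1 0 + mon 0 1) * r <> 1.
Proof.
pose phi : laurent 'F_2 -> 'F_2 := mmap idfun residue_weight.
have phi0 : phi 0 = 0 by apply: raddf0.
have phiD u v : phi (u + v) = phi u + phi v by apply: raddfD.
have phiU c m : phi << c *g m >> = c * residue_weight m by apply: mmapU.
have phi_mon c i j :
    phi ((1 + mon 1 0 + mon 0 1) * (<< c *g (i, j) >> : laurent 'F_2)) = 0.
  rewrite mulrDl mulrDl mul1r !monMU !add0r phiD phiD !phiU -!mulrDr.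
  by rewrite residue_weight_sum mulr0.
have {phi_mon} phi_r : phi ((1 + mon 1 0 + mon 0 1) * r) = 0.
  have -> : r = \sum_(m <- msupp r) (<< r@_m *g m >> : laurent 'F_2) := monalgE r.
  rewrite mulr_sumr (big_morph phi phiD phi0) big1 // => -[i j] _.
  exact: phi_mon.
move=> fr1; move: phi_r; rewrite fr1 => /eqP.
by rewrite [phi _]phiU.
Qed.

Lemma laurentF2_addrr (u : laurent 'F_2) : u + u = 0.
Proof.
apply: addrr_pchar2; apply: (rmorph_pchar (lconst 'F_2)).
exact: pchar_Fp.
Qed.

(** As f = g in characteristic 2, [(1, 1)] lies in the kernel; in the image it would make f a
    unit. *)
Lemma exception_not_topological :
  ~ topological (1 + mon 1 0 + mon 0 1 : laurent 'F_2) (1 + mon 1 0 + mon 0 1).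
Proof.
move=> /(_ (1, 1))[_]; case=> [|r [fr1 _]]; last exact: trinomial_not_unit fr1.
exact: laurentF2_addrr.
Qed.

(** * Exactness over ['F_2] and the case analysis *)

Lemma topologicalF2 (f g : laurent 'F_2) :
  (forall u v, g * u = f * v -> exists r, u = f * r /\ v = g * r) ->
  topological f g.
Proof.
move=> exact_fg [u v]; split=> [[r [<- <-]]|].
  by rewrite /hZdag /= [g * _]mulrCA laurentF2_addrr.
rewrite /hZdag /= => guDfv0.
have [|r [-> ->]] := exact_fg u v; last by exists r.
by apply: (addIr (f * v)); exact: etrans guDfv0 (esym (laurentF2_addrr _)).
Qed.

Lemma topological_of_regular (e : int) (alpha n s t s' t' : nat) (i j : int)
    (f g : laurent 'F_2) :
  e * e = 1 ->
  (forall U, rdvdp (Fpoly alpha n) (Gpoly s t s' t' * U) ->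
    rdvdp (Fpoly alpha n) U) ->
  f = 1 + mon 1 0 + mon (- alpha%:Z) (e * n%:Z) ->
  g = mon i j * iota 'F_2 e (Gpoly s t s' t') -> topological f g.
Proof.
move=> ee regFG -> ->; rewrite -iota_Fpoly; apply: topologicalF2.
apply: exact_of_regular (Fpoly_monic _ _) regFG (mon_inv _ _ _) (mon_inv _ _ _).
  by apply: iota_inj; apply: contra_eq_neq ee => ->; rewrite mul0r eq_sym oner_neq0.
exact: iota_clears_denominators.
Qed.

Lemma mon_mulDD (k : comNzRingType) a b i1 j1 i2 j2 i3 j3 :
  mon a b * (mon i1 j1 + mon i2 j2 + mon i3 j3) =
  mon (a + i1) (b + j1) + mon (a + i2) (b + j2) + mon (a + i3) (b + j3) :> laurent k.
Proof. by rewrite mulrDr mulrDr 3!monM. Qed.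

Theorem theorem1 (alpha beta : nat) (a b : int) :
  let x : laurent 'F_2 := mon 1 0 in
  let y : laurent 'F_2 := mon 0 1 in
  let f : laurent 'F_2 := 1 + x + mon (- alpha%:Z) b in
  let g : laurent 'F_2 := 1 + y + mon a (- beta%:Z) in
  topological f g <-> ~ [/\ alpha = 0%N, beta = 0%N, a = 1 & b = 1].
Proof.
move=> x y f g; split=> [topo_fg [ea eb ea' eb']|notex].
  have fE : f = 1 + mon 1 0 + mon 0 1 by rewrite /f ea eb' oppr0.
  have gE : g = 1 + mon 1 0 + mon 0 1.
 rewrite /g eb ea'.
  rewrite oppr0.
 exact: addrAC.
  move: topo_fg; rewrite fE gE.
  exact: exception_not_topological.
(* The disjunction tells which monomial of [(z + 1) z^s] becomes 1 and which becomes y; they swap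
   when [e = -1]. *)
have gE e s t s' t' i j : i + t%:Z = 0 -> i + t'%:Z = a ->
    (j + e * s%:Z = 0 /\ j + e * s.+1%:Z = 1) \/
    (j + e * s%:Z = 1 /\ j + e * s.+1%:Z = 0) ->
    j + e * s'%:Z = - beta%:Z ->
    g = mon i j * iota 'F_2 e (Gpoly s t s' t').
  move=> it it' js js'; rewrite iota_Gpoly mon_mulDD it it' js'.
  have addrAC0 (p q r : laurent 'F_2) : p + q + r = q + p + r by rewrite (addrC p).
  by case: js => -[-> ->]; [rewrite mon0 | rewrite mon0 addrAC0].
have fE e n : b = e * n%:Z -> f = 1 + mon 1 0 + mon (- alpha%:Z) (e * n%:Z).
  by move=> <-.
have [n [bE|[bE n_gt0]]]   :
    exists n : nat, b = 1 * n%:Z \/ b = -1 * n%:Z /\ (0 < n)%N.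
  by exists (absz b); lia.
- have [j [aE|aE]] : exists j : nat, a = j%:Z \/ a = - j%:Z by exists (absz a); lia.
    have gE' : g = mon 0 (- beta%:Z) * iota 'F_2 1 (Gpoly beta 0 0 j).
      by apply: gE; lia.
    apply: topological_of_regular (mulr1 1) _ (fE _ _ bE) gE'.
    (* When [alpha = 0] and [j > 0], F and G share the root x = 0 at z = 1, so the root of the
       linear F is used instead. *)
    case: (boolP ((0 < alpha) || (j == 0))%N) => [|]; first exact: Fpoly_regular_at1.
    rewrite negb_or -leqNgt leqn0 -lt0n => /andP[/eqP alpha0 j_gt0].
    rewrite alpha0; apply: Fpoly_regular_linear => // -[beta0 n1 j1].
    by apply: notex; rewrite bE aE n1 j1.
  (* For [a <= 0], multiplying by [x^j] frees the last monomial of x, so z = 1 works for every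
     [alpha]. *)
  have gE' : g = mon (- j%:Z) (- beta%:Z) * iota 'F_2 1 (Gpoly beta j 0 0).
    by apply: gE; lia.
  apply: topological_of_regular (mulr1 1) _ (fE _ _ bE) gE'.
  by apply: Fpoly_regular_at1; rewrite orbT.
have [j [aE|aE]] : exists j : nat, a = j%:Z \/ a = - j%:Z by exists (absz a); lia.
  (* With z the inverse of y, [y^-beta = y z^(beta+1)]; this exponent is positive, so z = 0
     works. *)
  have gE' : g = mon 0 1 * iota 'F_2 (-1) (Gpoly 0 0 beta.+1 j) by apply: gE; lia.
  apply: topological_of_regular (mulrNN 1 1) _ (fE _ _ bE) gE'.
  exact: Fpoly_regular_at0.
have gE' : g = mon (- j%:Z) 1 * iota 'F_2 (-1) (Gpoly 0 j beta.+1 0).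
  by apply: gE; lia.
apply: topological_of_regular (mulrNN 1 1) _ (fE _ _ bE) gE'.
by apply: Fpoly_regular_at1; rewrite orbT.
Qed.
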